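(* Let $D$ be a division ring and let $n$ be a positive integer. If the center of $D$ contains at least three elements, then every matrix in $\mathrm{M}_n(D)$ can be expressed as a sum of two diagonalizable matrices in $\mathrm{M}_n(D)$. Moreover, the number $2$ is sharp: it cannot in general be replaced by $1$, i.e. there exist a division ring $D$ whose center contains at least three elements, a positive integer $n$, and a matrix in $\mathrm{M}_n(D)$ that is not diagonalizable.
   Context: $\mathrm{M}_n(D)$ is the ring of $n\times n$ matrices over $D$. A square matrix over $D$ is diagonalizable if it is similar over $D$ (conjugate by an invertible matrix over $D$) to a diagonal matrix with entries in $D$. Division rings may be commutative or noncommutative. *)

(* Defs.v *)
From HB Require Import structures.
From mathcomp Require Import all_boot all_order all_algebra.

Set Implicit Arguments.
Unset Strict Implicit.
Unset Printing Implicit Defensive.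

Import GRing.Theory.
Local Open Scope ring_scope.

(* A unitRingType is nontrivial but need not be commutative, and
   GRing.field_axiom only says that its nonzero elements are units, so no
   commutativity is imposed. *)
Definition is_division_ring (D : unitRingType) : Prop := GRing.field_axiom D.

Definition central (R : pzRingType) (z : R) : Prop :=
  forall x : R, GRing.comm z x.

Definition center_has_three (R : pzRingType) : Prop :=
  exists a b c : R,
    [/\ central a, central b & central c] /\ [/\ a != b, a != c & b != c].

(* unitmx, invmx and the diagonalizable predicate of mxpoly are only available
   over commutative rings, so the inverse of a matrix is given explicitly and
   required to be two-sided. *)
Definition mutually_inverse_mx (R : pzRingType) (n : nat) (P Q : 'M[R]_n) :
  Prop := P *m Q = 1%:M /\ Q *m P = 1%:M.

Definition similar_mx (R : pzRingType) (n : nat) (A B : 'M[R]_n) : Prop :=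
  exists P Q : 'M[R]_n, mutually_inverse_mx P Q /\ P *m A *m Q = B.

Definition diagonalizable_mx (R : pzRingType) (n : nat) (A : 'M[R]_n) : Prop :=
  exists d : 'rV[R]_n, similar_mx A (diag_mx d).

(* Main.v *)
(* Let k + 1 be maximal such that some row u and column v satisfy u A^i v = 0
   for i < k and u A^k v = 1.  By maximality the spans of v, Av, ..., A^k v and
   of u, uA, ..., uA^k are A-invariant, and the Gram matrix of these families
   is unitriangular up to reordering; so A is similar to a companion block plus
   a smaller matrix, and it suffices to treat companion matrices.  There, pick
   central x, y, z pairwise distinct with z - x different from the last
   diagonal entry (if this fails, swap y and z), and write the companion matrix
   as B + C: the diagonal of B alternates between x and y and ends with z, B
   gets the rest of the last column and every other subdiagonal 1, and C gets
   the remainder, including the subdiagonal 1 in the last row.  In either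
   summand, the off-diagonal entries join distinct eigenvalues and can be
   conjugated away. *)
Require Import Defs.
From HB Require Import structures.
From mathcomp Require Import all_boot all_order all_algebra.
From mathcomp Require Import perm zify.

Set Implicit Arguments.
Unset Strict Implicit.
Unset Printing Implicit Defensive.

Import GRing.Theory.
Local Open Scope ring_scope.

(** * Separation and complements over a division ring *)

Lemma colspan_or_separated (D : unitRingType) (n k : nat)
    (P : 'M[D]_(n, k)) (w : 'cV[D]_n) :
  is_division_ring D ->
  (exists c : 'cV[D]_k, w = P *m c) \/
  (exists u : 'rV[D]_n, u *m P = 0 /\ u *m w = 1%:M).
Proof.
move=> divD; elim: k P w => [|k IH] P w.
  have [->|/cV0Pn [i nzi]] := eqVneq w 0.
    by left; exists 0; rewrite mulmx0.
  right; exists ((w i 0)^-1 *: delta_mx 0 i); split.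
    by rewrite [P]thinmx0 mulmx0.
  rewrite -scalemxAl -rowE; apply/matrixP=> a b.
  by rewrite !ord1 !mxE mulVr ?divD.
rewrite -[P](@hsubmxK _ n 1 k).
move: (@lsubmx _ n 1 k P) (@rsubmx _ n 1 k P) => p {}P.
have [[c ->]|[u' [u'P u'p]]] := IH P p.
  have [[c' ->]|[u [uP uw]]] := IH P w.
    left; exists (@col_mx _ 1 k _ 0 c').
    by rewrite (@mul_row_col _ n 1 k) mulmx0 add0r.
  right; exists u; split=> //.
  by rewrite (@mul_mx_row _ _ _ 1 k) mulmxA uP mul0mx row_mx0.
have [[c e]|[u [uP uw]]] := IH P (w - p *m (u' *m w)).
  left; exists (@col_mx _ 1 k _ (u' *m w) c); rewrite (@mul_row_col _ n 1 k) -e.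
  by rewrite addrC subrK.
(* Subtracting [(u p) u'] kills [p], and keeps [P] killed because [u' P = 0]. The value on [w]
   becomes that of [u] on [w - p (u' w)], which is 1. *)
right; exists (u - u *m p *m u'); split.
  rewrite (@mul_mx_row _ _ _ 1 k) !mulmxBl -!mulmxA u'P u'p !mulmx0 mulmx1 uP.
  by rewrite subrr subr0 row_mx0.
by rewrite -uw mulmxBr mulmxBl !mulmxA.
Qed.

(** Without commutativity, transposition reverses products only if the transposes are multiplied
    over the opposite ring. Column results over [D^c] thus become row results over [D]. *)
Lemma trmx_mulc (R : pzRingType) (m n p : nat)
    (A : 'M[R]_(m, n)) (B : 'M[R]_(n, p)) :
  (A *m B)^T = (B^T : 'M[R^c]_(p, n)) *m (A^T : 'M[R^c]_(n, m)).
Proof.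
by apply/matrixP=> i j; rewrite !mxE; apply: eq_bigr => l _; rewrite !mxE.
Qed.

Lemma rowspan_or_separated (D : unitRingType) (n k : nat)
    (U : 'M[D]_(k, n)) (w : 'rV[D]_n) :
  is_division_ring D ->
  (exists c : 'rV[D]_k, w = c *m U) \/
  (exists v : 'cV[D]_n, U *m v = 0 /\ w *m v = 1%:M).
Proof.
move=> divD.
have [[c e]|[u [uP uw]]] :=
  @colspan_or_separated D^c n k (U^T : 'M[D^c]_(n, k)) w^T divD.
  left; exists (c^T : 'M[D]_(1, k)); apply: trmx_inj.
  by rewrite trmx_mulc e trmxK.
right; exists (u^T : 'M[D]_(n, 1)); split; apply: trmx_inj.
  by rewrite trmx_mulc !trmxK uP trmx0.
by rewrite trmx_mulc !trmxK uw tr_scalar_mx.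
Qed.

Lemma dual_pair_complement1_block (D : unitRingType) (n : nat)
    (be : 'M[D]_1) (b : 'rV[D]_n) (al : 'M[D]_1) (a : 'cV[D]_n) :
  is_division_ring D -> al 0 0 != 0 ->
  row_mx be b *m col_mx al a = 1%:M ->
  exists (S : 'M[D]_(1 + n, n)) (T : 'M[D]_(n, 1 + n)),
    [/\ row_mx be b *m S = 0, T *m col_mx al a = 0, T *m S = 1%:M
      & col_mx al a *m row_mx be b + S *m T = 1%:M].
Proof.
move=> divD al_nz; rewrite mul_row_col => ba.
have [ai aiV aVi] : exists2 ai : 'M[D]_1, ai *m al = 1%:M & al *m ai = 1%:M.
  exists (al 0 0)^-1%:M; apply/matrixP=> i j.
    by rewrite !ord1 !mxE big_ord1 !mxE mulVr ?divD.
  by rewrite !ord1 !mxE big_ord1 !mxE mulrV ?divD.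
have eb : be *m al = 1%:M - b *m a by rewrite -ba addrK.
(* [S] is the last [n] columns of the idempotent [1 - col_mx al a *m row_mx be b]. [T] projects onto
   the last [n] coordinates along [col_mx al a], which is possible because [al] is invertible. *)
exists (col_mx (- (al *m b)) (1%:M - a *m b)), (row_mx (- (a *m ai)) 1%:M).
split.
- rewrite mul_row_col mulmxN mulmxA eb mulmxBl mulmxBr mulmx1 mul1mx.
  by rewrite mulmxA addrC subrr.
- by rewrite mul_row_col mulNmx -mulmxA aiV mulmx1 mul1mx addNr.
- rewrite mul_row_col mulmxN mulNmx opprK mul1mx mulmxA -(mulmxA a) aiV mulmx1.
  by rewrite addrC subrK.
rewrite !mul_col_row add_block_mx !mulmx1 mulmxN mulNmx opprK subrr.
have -> : al *m be + al *m b *m (a *m ai) = 1%:M.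
  rewrite -{1}[be]mulmx1 -aVi !mulmxA -mulmxDl -!(mulmxA al) -mulmxDr ba.
  by rewrite mulmx1.
rewrite mulmxN mulmxBl mul1mx opprB addrA.
rewrite [a *m b + _]addrC subrK.
have -> : a *m be + a *m b *m (a *m ai) = a *m ai.
  rewrite -{1}[be]mulmx1 -aVi !mulmxA -mulmxDl -!(mulmxA a) -mulmxDr ba.
  by rewrite mulmx1.
by rewrite subrr -scalar_mx_block.
Qed.

Lemma dual_pair_complement1 (D : unitRingType) (n : nat)
    (b : 'rV[D]_n) (a : 'cV[D]_n) :
  is_division_ring D -> b *m a = 1%:M ->
  exists (m : nat) (S : 'M[D]_(n, m)) (T : 'M[D]_(m, n)),
    [/\ n = (1 + m)%N, b *m S = 0, T *m a = 0, T *m S = 1%:M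
      & a *m b + S *m T = 1%:M].
Proof.
move=> divD ba.
have [i nzi] : exists i, a i 0 != 0.
  apply/cV0Pn; apply: contra_eq_neq ba => ->.
  rewrite mulmx0 eq_sym; apply/eqP => /matrixP/(_ 0 0)/eqP.
  by rewrite !mxE oner_eq0.
case: n => [|n] in b a ba i nzi *; first by case: i {nzi}.
(* The involution [s] swaps coordinates [i] and 0, bringing a nonzero entry of [a] to the front. *)
wlog i0 : b a ba i nzi / i = 0.
  move=> W; pose s := tperm_mx i 0 : 'M[D]_n.+1.
  have ss : s *m s = 1%:M by rewrite -perm_mxM tperm2 perm_mx1.
  have ba' : (b *m s) *m (s *m a) = 1%:M.
    by rewrite mulmxA -(mulmxA b) ss mulmx1.
  have sai : (s *m a) 0 0 != 0.
    by rewrite -row_permE mxE tpermR.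
  have [m [S [T [en bS Ta TS e]]]] := W _ _ ba' 0 sai erefl.
  exists m, (s *m S), (T *m s); split=> //; first by rewrite mulmxA.
  - by rewrite -mulmxA.
  - by rewrite mulmxA -(mulmxA T) ss mulmx1.
  rewrite -ss -[X in _ = s *m X]mul1mx -e mulmxDl mulmxDr !mulmxA ss mul1mx.
  by rewrite -(mulmxA _ s s) ss mulmx1.
move: nzi; rewrite {}i0 {i}.
have [be [b' eb]] : exists (be : 'M[D]_1) (b' : 'rV[D]_n), b = row_mx be b'.
  by exists (@lsubmx _ 1 1 n b), (@rsubmx _ 1 1 n b); rewrite (@hsubmxK _ 1 1 n).
have [al [a' ea]] : exists (al : 'M[D]_1) (a' : 'cV[D]_n), a = col_mx al a'.
  by exists (@usubmx _ 1 n 1 a), (@dsubmx _ 1 n 1 a); rewrite (@vsubmxK _ 1 n 1).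
rewrite {b}eb {a}ea in ba * => nz.
have al_nz : al 0 0 != 0.
  by rewrite -(col_mxEu al a'); congr (col_mx _ _ _ _ != 0): nz; apply: val_inj.
have [S [T [? ? ? ?]]] := dual_pair_complement1_block divD al_nz ba.
by exists n, S, T; split.
Qed.

(** [P U] is idempotent, and [S T] factors the complementary idempotent through its range. The
    equation [n = k + m] also serves as the dimension count. *)
Lemma dual_pair_complement (D : unitRingType) (n k : nat)
    (U : 'M[D]_(k, n)) (P : 'M[D]_(n, k)) :
  is_division_ring D -> U *m P = 1%:M ->
  exists (m : nat) (S : 'M[D]_(n, m)) (T : 'M[D]_(m, n)),
    [/\ n = (k + m)%N, U *m S = 0, T *m P = 0, T *m S = 1%:M
      & P *m U + S *m T = 1%:M].
Proof.
move=> divD; elim: k U P => [|k IH] U P UP.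
  exists n, 1%:M, 1%:M; split; rewrite ?mulmx1 ?[P]thinmx0 ?[U]flatmx0 ?mulmx0 //.
  by rewrite add0r.
rewrite -[P](@hsubmxK _ n 1 k) -[U](@vsubmxK _ 1 k n) in UP *.
move: (@lsubmx _ n 1 k P) (@rsubmx _ n 1 k P) UP => p {}P.
move: (@usubmx _ 1 k n U) (@dsubmx _ 1 k n U) => q {}U.
rewrite (@mul_col_row _ 1 k n 1 k) (@scalar_mx_block _ 1 k).
move=> /(@eq_block_mx _ 1 k 1 k) [qp qP Up UP].
have [m [S [T [en US TP TS e]]]] := IH _ _ UP.
(* Since [U p = 0] and [q P = 0], both [p] and [q] live on the complement of the smaller pair. There
   [q S] and [T p] form a dual pair of size one, whose complement is the one sought. *)
have ST_p : S *m (T *m p) = p.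
  by rewrite -[RHS]mul1mx -e mulmxDl -!mulmxA Up mulmx0 add0r.
have q_ST : q *m S *m T = q.
  by rewrite -[RHS]mulmx1 -e mulmxDr !mulmxA qP mul0mx add0r.
have ba : (q *m S) *m (T *m p) = 1%:M by rewrite -mulmxA ST_p.
have [m' [S' [T' [em bS Ta TS' e']]]] := dual_pair_complement1 divD ba.
exists m', (S *m S'), (T' *m T); split.
- by rewrite en em addnCA addnA.
- by rewrite (@mul_col_mx _ 1 k) !mulmxA bS US mul0mx col_mx0.
- by rewrite (@mul_mx_row _ _ _ 1 k) -!mulmxA TP Ta mulmx0 row_mx0.
- by rewrite mulmxA -(mulmxA T') TS mulmx1.
rewrite (@mul_row_col _ n 1 k) -ST_p -q_ST -[RHS]e.
rewrite addrAC addrC; congr (_ + _).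
transitivity (S *m (T *m p *m (q *m S) + S' *m T') *m T).
  by rewrite mulmxDr mulmxDl !mulmxA.
by rewrite e' mulmx1.
Qed.

(** * Krylov families and the companion block they split off *)

Lemma upper_unitriangular_inv (R : pzRingType) (n : nat) (M : 'M[R]_n) :
  (forall i j : 'I_n, (j < i)%N -> M i j = 0) -> (forall i, M i i = 1) ->
  exists N : 'M[R]_n, mutually_inverse_mx M N.
Proof.
elim: n M => [|n IH] M tri diag.
  by exists 0; split; apply/matrixP; case.
rewrite -[M](@submxK _ 1 n 1 n).
have -> : @ulsubmx _ 1 n 1 n M = 1%:M.
  apply/matrixP=> i j; rewrite !ord1 !mxE -[RHS](diag 0).
  by congr (M _ _); apply: val_inj.
have -> : @dlsubmx _ 1 n 1 n M = 0.
  by apply/matrixP=> i j; rewrite !mxE tri //= ord1.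
have [N [MN NM]] : exists N, mutually_inverse_mx (@drsubmx _ 1 n 1 n M) N.
  apply: IH => [i j lt|i]; rewrite !mxE ?diag // tri //=.
move: (@ursubmx _ 1 n 1 n M) => r.
exists (@block_mx _ 1 n 1 n 1%:M (- (r *m N)) 0 N); split;
  rewrite (@mulmx_block _ 1 n 1 n 1 n) (@scalar_mx_block _ 1 n);
  rewrite !(mul1mx, mulmx1, mul0mx, mulmx0, addr0, add0r).
  by rewrite MN addNr.
by rewrite NM mulNmx -mulmxA NM mulmx1 subrr.
Qed.

Definition krylov_cols (R : pzRingType) (n : nat) (A : 'M[R]_n) (k : nat)
    (v : 'cV[R]_n) : 'M[R]_(n, k.+1) :=
  \matrix_(i, j) (A ^+ j *m v) i 0.

(* Decreasing powers, so that [krylov_rows A k u *m krylov_cols A k v] is upper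
   unitriangular for a dual pair. *)
Definition krylov_rows (R : pzRingType) (n : nat) (A : 'M[R]_n) (k : nat)
    (u : 'rV[R]_n) : 'M[R]_(k.+1, n) :=
  \matrix_(i, j) (u *m A ^+ (k - i)) 0 j.

Definition krylov_dual (R : pzRingType) (n : nat) (A : 'M[R]_n) (k : nat)
    (u : 'rV[R]_n) (v : 'cV[R]_n) : Prop :=
  (forall i, (i < k)%N -> u *m A ^+ i *m v = 0) /\ u *m A ^+ k *m v = 1%:M.

Definition companion (R : pzRingType) (k : nat) (c : 'cV[R]_k.+1) :
    'M[R]_k.+1 :=
  \matrix_(i, j) if j == k :> nat then c i 0 else (i == j.+1 :> nat)%:R.

Lemma krylov_colsE (R : pzRingType) (m n k : nat) (A : 'M[R]_n)
    (X : 'M[R]_(m, n)) (v : 'cV[R]_n) i j :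
  (X *m krylov_cols A k v) i j = (X *m (A ^+ j *m v)) i 0.
Proof. by rewrite !mxE; apply: eq_bigr => l _; rewrite !mxE. Qed.

Lemma krylov_rowsE (R : pzRingType) (m n k : nat) (A : 'M[R]_n)
    (X : 'M[R]_(n, m)) (u : 'rV[R]_n) i j :
  (krylov_rows A k u *m X) i j = (u *m A ^+ (k - i) *m X) 0 j.
Proof. by rewrite mxE [RHS]mxE; apply: eq_bigr => l _; rewrite !mxE. Qed.

Lemma krylov_gram_inv (R : pzRingType) (n k : nat) (A : 'M[R]_n)
    (u : 'rV[R]_n) (v : 'cV[R]_n) :
  krylov_dual A k u v ->
  exists N, mutually_inverse_mx (krylov_rows A k u *m krylov_cols A k v) N.
Proof.
move=> [uv0 uv1].
have E i j : (krylov_rows A k u *m krylov_cols A k v) i j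
    = (u *m A ^+ (k - i + j) *m v) 0 0.
  by rewrite krylov_rowsE krylov_colsE exprD !mulmxA.
apply: upper_unitriangular_inv => [i j lt|i]; rewrite E.
  rewrite uv0 ?mxE //; have := ltn_ord i; lia.
by rewrite subnK ?uv1 ?mxE // -ltnS.
Qed.

(** The inverse Gram matrix turns the two families into an exact dual pair of size [k + 1], which
    must fit into dimension [n]. *)
Lemma krylov_dual_bound (D : unitRingType) (n k : nat) (A : 'M[D]_n)
    (u : 'rV[D]_n) (v : 'cV[D]_n) :
  is_division_ring D -> krylov_dual A k u v -> (k < n)%N.
Proof.
move=> divD /krylov_gram_inv [N [_]]; rewrite mulmxA => NUP.
have [m [_ [_ [en _ _ _ _]]]] := dual_pair_complement divD NUP.
by rewrite en leq_addr.
Qed.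

(** If [A^(k+1) v] leaves the column span, a separating row [u'] makes [(u', v)] a dual pair of
    length [k + 1]; rows are symmetric. The bound [k < n] stops this growth, and then both spans are
    invariant. *)
Lemma maximal_krylov_dual (D : unitRingType) (n : nat) (A : 'M[D]_n) :
  is_division_ring D -> (0 < n)%N ->
  exists k u v, [/\ krylov_dual A k u v,
    exists c, A ^+ k.+1 *m v = krylov_cols A k v *m c
    & exists c, u *m A ^+ k.+1 = c *m krylov_rows A k u].
Proof.
move=> divD n_gt0.
have [k [u [v uv]]] : exists k u v, krylov_dual A k u v.
  exists 0%N, (delta_mx 0 (Ordinal n_gt0)), (delta_mx (Ordinal n_gt0) 0).
  split=> //; rewrite expr0 mulmx1 mul_delta_mx.
  by apply/matrixP=> i j; rewrite !ord1 !mxE.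
have [d] : exists d, (n - k <= d)%N by exists n; lia.
elim: d k u v uv => [|d IH] k u v uv.
  by have := krylov_dual_bound divD uv; lia.
move=> le_d.
have [Pc|[u' [u'P u'w]]] :=
    colspan_or_separated (krylov_cols A k v) (A ^+ k.+1 *m v) divD.
  have [Uc|[v' [Uv' wv']]] :=
    rowspan_or_separated (krylov_rows A k u) (u *m A ^+ k.+1) divD.
    by exists k, u, v.
  apply: (IH k.+1 u v'); last by lia.
  split=> // i lt_i; apply/matrixP=> a b.
  (* Powers decrease along the rows, so [u A^i] is row [k - i]. *)
  have lt_ki : (k - i < k.+1)%N by lia.
  have := krylov_rowsE A v' u (Ordinal lt_ki) b; rewrite Uv' /= subKn //.
  by rewrite !ord1 !mxE => <-.
apply: (IH k.+1 u' v); last by lia.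
split=> [i lt_i|]; last by rewrite -mulmxA.
apply/matrixP=> a b.
have := krylov_colsE A u' v a (Ordinal lt_i); rewrite u'P /= mulmxA.
by rewrite !ord1 !mxE => <-.
Qed.

(** In the basis formed by [P] and a basis [S] of the kernel of [U], invariance of the column span
    kills the lower left block, and invariance of the row span kills the upper right one. *)
Lemma companion_split (D : unitRingType) (n : nat) (A : 'M[D]_n) :
  is_division_ring D -> (0 < n)%N ->
  exists (k m : nat) (c : 'cV[D]_k.+1) (A' : 'M[D]_m)
      (L : 'M[D]_(k.+1 + m, n)) (R : 'M[D]_(n, k.+1 + m)),
    [/\ n = (k.+1 + m)%N, L *m R = 1%:M, R *m L = 1%:M
      & L *m A *m R = block_mx (companion c) 0 0 A'].
Proof.
move=> divD n_gt0.
have [k [u [v [uv [c Pc] [c' Uc]]]]] := maximal_krylov_dual A divD n_gt0.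
have [N [GN NG]] := krylov_gram_inv uv.
set P := krylov_cols A k v in Pc GN NG.
set U := krylov_rows A k u in Uc GN NG.
have AP : A *m P = P *m companion c.
  apply/matrixP=> i j; rewrite krylov_colsE.
  rewrite mulmxA -[A *m A ^+ j]exprS.
  case: (eqVneq (j : nat) k) => [ej|nj].
    rewrite ej Pc mxE [RHS]mxE; apply: eq_bigr => l _.
    by rewrite !mxE ej eqxx.
  have lt_j : (j.+1 < k.+1)%N by have := ltn_ord j; lia.
  rewrite [RHS]mxE (bigD1 (Ordinal lt_j)) //= big1 => [|l ne_l].
    by rewrite !mxE (negPf nj) eqxx mulr1 addr0.
  rewrite !mxE (negPf nj) (_ : l == j.+1 :> nat = false) ?mulr0 //.
  by apply: contraNF ne_l => /eqP e; apply/eqP/val_inj.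
have [C' UA] : exists C', U *m A = C' *m U.
  (* Row 0 is [u A^k], so it alone needs the relation [c']; multiplying any other row by [A] gives
     the row just above it. *)
  exists (\matrix_(i, j) if i == 0 :> nat then c' 0 j
                         else (i == j.+1 :> nat)%:R).
  apply/matrixP=> i j; rewrite krylov_rowsE.
  rewrite -mulmxA -[A ^+ _ *m A]exprSr.
  case: (eqVneq (i : nat) 0%N) => [ei|ni].
    rewrite ei subn0 Uc mxE [RHS]mxE; apply: eq_bigr => l _.
    by rewrite !mxE ei eqxx.
  have lt_i : (i.-1 < k.+1)%N by have := ltn_ord i; lia.
  have ei : (k - i).+1 = (k - i.-1)%N by have := ltn_ord i; lia.
  rewrite [RHS]mxE (bigD1 (Ordinal lt_i)) //= big1 => [|l ne_l].
    by rewrite !mxE (negPf ni) /= prednK ?lt0n // eqxx mul1r addr0 ei.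
  rewrite !mxE (negPf ni) (_ : i == l.+1 :> nat = false) ?mul0r //.
  by apply: contraNF ne_l => /eqP e; apply/eqP/val_inj; rewrite /= e.
have N_UP : N *m U *m P = 1%:M by rewrite -mulmxA.
have [m [S [T [en US TP TS e]]]] := dual_pair_complement divD N_UP.
have US0 : U *m S = 0.
  by rewrite -[U]mul1mx -GN -!mulmxA (mulmxA N) US !mulmx0.
exists k, m, c, (T *m A *m S), (col_mx (N *m U) T), (row_mx P S); split=> //.
- by rewrite mul_col_row N_UP US TP TS -scalar_mx_block.
- by rewrite mul_row_col.
rewrite mul_col_mx mul_col_row -!(mulmxA _ A) AP.
rewrite [in X in block_mx X]mulmxA N_UP mul1mx.
rewrite -(mulmxA N) (mulmxA U) UA -(mulmxA C') US0 !mulmx0.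
by rewrite (mulmxA T P) TP mul0mx.
Qed.

(** * Similarity, block sums and diagonalization by conjugation *)

Lemma similar_mx_trans (R : pzRingType) (n : nat) (A B C : 'M[R]_n) :
  similar_mx A B -> similar_mx B C -> similar_mx A C.
Proof.
move=> [P [Q [[PQ QP] <-]]] [P' [Q' [[PQ' QP'] <-]]].
exists (P' *m P), (Q *m Q'); split; last by rewrite !mulmxA.
split; first by rewrite -mulmxA (mulmxA P) PQ mul1mx.
by rewrite -mulmxA (mulmxA Q') QP' mul1mx.
Qed.

Lemma similar_diagonalizable (R : pzRingType) (n : nat) (A B : 'M[R]_n) :
  similar_mx A B -> diagonalizable_mx B -> diagonalizable_mx A.
Proof. by move=> AB [d Bd]; exists d; apply: similar_mx_trans AB Bd. Qed.

Lemma diagonalizable_block (R : pzRingType) (m n : nat)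
    (A : 'M[R]_m) (B : 'M[R]_n) :
  diagonalizable_mx A -> diagonalizable_mx B ->
  diagonalizable_mx (block_mx A 0 0 B).
Proof.
move=> [d [P [Q [[PQ QP] eA]]]] [e [P' [Q' [[PQ' QP'] eB]]]].
exists (row_mx d e), (block_mx P 0 0 P'), (block_mx Q 0 0 Q').
split; first split;
  rewrite ?diag_mx_row !mulmx_block !(mul0mx, mulmx0, addr0, add0r).
- by rewrite PQ PQ' -scalar_mx_block.
- by rewrite QP QP' -scalar_mx_block.
by rewrite eA eB.
Qed.

Definition sum_of_two_diagonalizable (R : pzRingType) (n : nat) (A : 'M[R]_n) :
    Prop :=
  exists B C : 'M[R]_n,
    [/\ diagonalizable_mx B, diagonalizable_mx C & A = B + C].

Lemma similar_sum_of_two (R : pzRingType) (n : nat) (A B : 'M[R]_n) :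
  similar_mx A B -> sum_of_two_diagonalizable B -> sum_of_two_diagonalizable A.
Proof.
move=> [P [Q [[PQ QP] <-]]] [B1 [B2 [dB1 dB2 eB]]].
have sim X : similar_mx (Q *m X *m P) X.
  exists P, Q; split=> //; rewrite !mulmxA PQ mul1mx.
  by rewrite -mulmxA PQ mulmx1.
exists (Q *m B1 *m P), (Q *m B2 *m P); split.
- exact: similar_diagonalizable (sim B1) dB1.
- exact: similar_diagonalizable (sim B2) dB2.
rewrite -mulmxDl -mulmxDr -eB !mulmxA QP mul1mx.
by rewrite -mulmxA QP mulmx1.
Qed.

Lemma sum_of_two_block (R : pzRingType) (m n : nat)
    (A : 'M[R]_m) (B : 'M[R]_n) :
  sum_of_two_diagonalizable A -> sum_of_two_diagonalizable B ->
  sum_of_two_diagonalizable (block_mx A 0 0 B).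
Proof.
move=> [A1 [A2 [dA1 dA2 ->]]] [B1 [B2 [dB1 dB2 ->]]].
exists (block_mx A1 0 0 B1), (block_mx A2 0 0 B2).
split; try exact: diagonalizable_block.
by rewrite add_block_mx !addr0.
Qed.

(* Solves [diag_mx d *m X - X *m diag_mx d = N] when [d 0 j] is central and
   differs from [d 0 i] wherever [N i j] is nonzero. *)
Definition sylvester_mx (R : unitRingType) (n : nat) (d : 'rV[R]_n)
    (N : 'M[R]_n) : 'M[R]_n :=
  \matrix_(i, j) ((d 0 i - d 0 j)^-1 * N i j).

(* With X := sylvester_mx d N, bipartite support gives X^2 = X diag(d) X = 0, so
   1 + X conjugates diag(d) + N to diag(d). *)
Lemma diag_add_bipartite (D : unitRingType) (n : nat) (s : pred 'I_n)
    (d : 'rV[D]_n) (N : 'M[D]_n) (X := sylvester_mx d N) :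
  is_division_ring D ->
  (forall i j, N i j != 0 ->
    [/\ s i, ~~ s j, central (d 0 j) & d 0 i != d 0 j]) ->
  mutually_inverse_mx (1%:M + X) (1%:M - X) /\
  (1%:M + X) *m (diag_mx d + N) *m (1%:M - X) = diag_mx d.
Proof.
move=> divD supp.
have X0 i j : N i j = 0 -> X i j = 0 by rewrite mxE => ->; rewrite mulr0.
(* A nonzero term would put [l] both outside and inside [s]. The weights [Y] cover [X^2] and
   [X diag(d) X] at once. *)
have XYX (Y : 'I_n -> D) i j : \sum_l X i l * Y l * X l j = 0.
  apply: big1 => l _.
  have [/X0->|/supp [_ nsl _ _]] := eqVneq (N i l) 0; first by rewrite !mul0r.
  have [/X0->|/supp [sl _ _ _]] := eqVneq (N l j) 0; first by rewrite mulr0.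
  by rewrite sl in nsl.
have XX : X *m X = 0.
  apply/matrixP=> i j; rewrite [RHS]mxE -(XYX (fun=> 1) i j) mxE.
  by apply: eq_bigr => l _; rewrite mulr1.
have XdX : X *m diag_mx d *m X = 0.
  apply/matrixP=> i j; rewrite [RHS]mxE -(XYX (fun l => d 0 l) i j) mxE.
  by apply: eq_bigr => l _; rewrite mul_mx_diag !mxE.
have eN : N = diag_mx d *m X - X *m diag_mx d.
  apply/matrixP=> i j; rewrite mul_mx_diag mul_diag_mx !mxE.
  have [->|nz] := eqVneq (N i j) 0; first by rewrite !(mulr0, mul0r) subrr.
  (* Centrality moves [d 0 j] to the left, so that [d 0 i - d 0 j] meets its inverse. *)
  have [_ _ cj ne] := supp _ _ nz.
  rewrite -[_ * N i j * _]cj -mulrBl mulrA mulrV ?mul1r //.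
  by rewrite divD ?subr_eq0.
have inv1 : (1%:M + X) *m (1%:M - X) = 1%:M.
  by rewrite mulmxDl !mulmxBr !(mulmx1, mul1mx) XX subr0 subrK.
have inv2 : (1%:M - X) *m (1%:M + X) = 1%:M.
  by rewrite mulmxBl !mulmxDr !(mulmx1, mul1mx) XX addr0 addrK.
split=> //.
have -> : (1%:M + X) *m (diag_mx d + N) = diag_mx d *m (1%:M + X).
  rewrite eN mulmxDl mul1mx !mulmxDr mulmxN mulmx1 !mulmxA XdX XX mul0mx.
  by rewrite subr0 addr0 -addrA subrK.
by rewrite -mulmxA inv1 mulmx1.
Qed.

(** * Companion matrices and the induction on size *)

Lemma companion_sum_of_two (D : unitRingType) (k : nat) (c : 'cV[D]_k.+1)
    (x y z : D) :
  is_division_ring D -> central x -> central y -> central z ->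
  x != y -> x != z -> y != z -> c ord_max 0 != z - x ->
  sum_of_two_diagonalizable (companion c).
Proof.
move=> divD cx cy cz xy xz yz ck.
(* Parity is counted from the end, so index [k - 1] always carries [x]. This is why [ck] excludes
   only [z - x]. *)
pose d1 : 'rV[D]_k.+1 := \row_i
  if i == k :> nat then z else if odd (k - i) then x else y.
pose d2 : 'rV[D]_k.+1 := \row_i
  if i == k :> nat then c ord_max 0 - z else if odd (k - i) then - x else - y.
pose sub (b : bool) : 'M[D]_k.+1 :=
  \matrix_(i, j) ((i == j.+1 :> nat) && (odd (k - j) == b))%:R.
pose W : 'M[D]_k.+1 :=
  \matrix_(i, j) if (j == k :> nat) && (i != k :> nat) then c i 0 else 0.
have subP b (i j : 'I_k.+1) : sub b i j != 0 ->
    [/\ i = j.+1 :> nat, (j < k)%N, odd (k - j) = b & odd (k - i) = ~~ b].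
  rewrite mxE; case: andP => [[/eqP e /eqP o] _|_]; last by rewrite eqxx.
  have := ltn_ord i; rewrite e ltnS => lt_jk.
  by split=> //; rewrite -o -(subnSK lt_jk) /= negbK.
have WP i j : W i j != 0 -> j = k :> nat /\ i <> k :> nat.
  by rewrite mxE; case: andP => [[/eqP ? /eqP ?]|]; rewrite ?eqxx.
exists (diag_mx d1 + sub false + W), (diag_mx d2 + sub true); split.
(* The first summand takes two conjugations: one removes [sub false], the next removes what has
   become of [W]. *)
- pose X := sylvester_mx d1 (sub false).
  have [] := @diag_add_bipartite D _ (fun i => odd (k - i)) d1 (sub false) divD.
    move=> i j /subP [e lt_jk oj oi]; rewrite !mxE oi oj.
    have -> : (j == k :> nat) = false by lia.
    have -> : (i == k :> nat) = false.
      by apply/eqP => ei; rewrite ei subnn in oi.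
    by split.
  rewrite -/X => invX eX.
  have Xk (i j : 'I_k.+1) : i = k :> nat -> X i j = 0.
    move=> ei; have [e0|/subP [_ _ _]] := eqVneq (sub false i j) 0.
      by rewrite mxE e0 mulr0.
    by rewrite ei subnn.
  (* [W] lives in column [k], and row [k] of [X] vanishes because the last subdiagonal 1 belongs to
     [sub true]. *)
  have WX : W *m X = 0.
    apply/matrixP=> i j; rewrite !mxE big1 // => l _.
    by have [->|/WP [/Xk-> _]] := eqVneq (W i l) 0; rewrite ?mul0r ?mulr0.
  apply: (@similar_diagonalizable _ _ _ (diag_mx d1 + (1%:M + X) *m W)).
    exists (1%:M + X), (1%:M - X); split=> //.
    rewrite (mulmxDr _ _ W) [LHS]mulmxDl eX; congr (_ + _).
    by rewrite -mulmxA mulmxBr mulmx1 WX subr0.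
  (* [(1 + X) W] is still confined to the last column above its last entry, where [z] faces only [x]
     or [y]. *)
  exists d1; eexists _, _.
  apply: (@diag_add_bipartite D _ (fun i => i != k :> nat)) => // i j nz.
  have [ej ni] : j = k :> nat /\ i <> k :> nat.
    split; apply/eqP; apply: contraNT nz.
      move=> nj; rewrite mxE big1 // => l _.
      have [->|/WP [e _]] := eqVneq (W l j) 0; first by rewrite mulr0.
      by rewrite e eqxx in nj.
    rewrite negbK => /eqP ei; rewrite mulmxDl mul1mx mxE.
    have [->|/WP [_ //]] := eqVneq (W i j) 0.
    by rewrite mxE big1 ?addr0 // => l _; rewrite Xk ?mul0r.
  rewrite !mxE ej eqxx; move/eqP: (ni) => /negPf->.
  by split=> //; case: odd.
(* Each nonzero entry of [sub true] has column eigenvalue [- x], which is central, and row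
   eigenvalue [- y] or [c ord_max 0 - z]. The latter may fail to be central, but it differs from
   [- x] by [ck]. *)
- exists d2; eexists _, _.
  apply: (@diag_add_bipartite D _ (fun i => ~~ odd (k - i))) => // i j.
  move=> /subP [e lt_jk oj oi]; rewrite !mxE oi oj.
  have -> : (j == k :> nat) = false by lia.
  split=> //; first by move=> t; apply/commr_sym/commrN/commr_sym/cx.
  case: ifP => _; last by rewrite eqr_opp eq_sym.
  by rewrite -subr_eq0 opprK -addrA [- z + x]addrC -opprB subr_eq0.
apply/matrixP=> i j; rewrite !mxE.
have [e|nij] := eqVneq i j.
  rewrite {i}e !mulr1n; have -> : (j == j.+1 :> nat) = false by lia.
  rewrite andbN !addr0 /=; case: eqP => [ej|_]; last by case: odd; rewrite subrr.
  by rewrite addrC subrK; congr (c _ _); apply: val_inj.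
have ni : (i == j :> nat) = false by apply/negbTE.
rewrite !mulr0n !add0r; case: eqP => [ej|_].
  have -> : (i == k :> nat) = false by lia.
  have -> : (i == j.+1 :> nat) = false by have := ltn_ord i; lia.
  by rewrite addr0 add0r.
by rewrite /= addr0; case: (_ == j.+1); case: odd; rewrite /= ?addr0 ?add0r.
Qed.

Lemma matrix_sum_of_two (D : unitRingType) (n : nat) (A : 'M[D]_n) :
  is_division_ring D -> center_has_three D -> sum_of_two_diagonalizable A.
Proof.
move=> divD [x [y [z [[cx cy cz] [xy xz yz]]]]].
have [d] := ubnP n; elim: d n A => // d IH n A le_nd.
(* Size 0 does occur in the induction, when the companion block fills the whole matrix. *)
have [n0|n_gt0] := posnP n.
  rewrite n0 in A *; exists 0, 0; split; last by rewrite [A]flatmx0 addr0.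
    by exists 0, 1%:M, 1%:M; split; [split|]; rewrite [LHS]flatmx0 [RHS]flatmx0.
  by exists 0, 1%:M, 1%:M; split; [split|]; rewrite [LHS]flatmx0 [RHS]flatmx0.
have [k [m [c [A' [L [R [en LR RL eA]]]]]]] := companion_split A divD n_gt0.
subst n; apply: (@similar_sum_of_two _ _ _ (block_mx (companion c) 0 0 A')).
  by exists L, R.
apply: sum_of_two_block; last by apply: IH; lia.
have [ck|ck] := eqVneq (c ord_max 0) (z - x).
  apply: (@companion_sum_of_two _ _ _ x z y) => //; first by rewrite eq_sym.
  by rewrite ck (inj_eq (addIr _)) eq_sym.
exact: (@companion_sum_of_two _ _ _ x y z).
Qed.

(** * Sharpness and conclusion *)

(** The matrix squares to zero, whereas over a domain a diagonal matrix of square zero is itself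
    zero, and so is anything similar to it. *)
Lemma delta_mx01_not_diagonalizable (R : idomainType) :
  ~ diagonalizable_mx (delta_mx 0 1 : 'M[R]_2).
Proof.
move=> [d [P [Q [[PQ QP] e]]]].
have dd : diag_mx d *m diag_mx d = 0.
  rewrite -e !mulmxA -(mulmxA _ Q P) QP mulmx1 -(mulmxA P) mul_delta_mx_0 //.
  by rewrite mulmx0 mul0mx.
have d0 : diag_mx d = 0.
  apply/matrixP=> i j; rewrite !mxE; case: eqP => [_|_]; last by rewrite mulr0n.
  move/matrixP: dd => /(_ i i); rewrite mulmx_diag !mxE eqxx mulr1n => /eqP.
  by rewrite mulf_eq0 orbb => /eqP->.
have : delta_mx 0 1 = 0 :> 'M[R]_2.
  rewrite -[LHS]mul1mx -QP -[LHS]mulmx1 -QP -!mulmxA (mulmxA P) (mulmxA _ Q).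
  by rewrite e d0 mul0mx mulmx0.
by move/matrixP=> /(_ 0 1) /eqP; rewrite !mxE !eqxx oner_eq0.
Qed.

Theorem theorem2p6 :
  (forall (D : unitRingType) (n : nat),
      is_division_ring D -> (0 < n)%N -> center_has_three D ->
      forall A : 'M[D]_n,
        exists B C : 'M[D]_n,
          [/\ diagonalizable_mx B, diagonalizable_mx C & A = B + C])
  /\
  (exists (D : unitRingType) (n : nat),
      [/\ is_division_ring D, center_has_three D, (0 < n)%N
        & exists A : 'M[D]_n, ~ diagonalizable_mx A]).
Proof.
split=> [D n divD _ three A|]; first exact: matrix_sum_of_two.
exists rat, 2%N; split=> //.
- by exists 0, 1, 2%:R; split; split=> // x; apply: mulrC.
by exists (delta_mx 0 1); apply: delta_mx01_not_diagonalizable.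
Qed.
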